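(* Let $c>0$, $k>0$ and $v\in\mathbb{R}^d$. Let $\xi$ be a zero-mean random vector in $\mathbb{R}^d$ with density $p$ and variance $\sigma_\xi^2=\mathbb{E}\|\xi\|^2<\infty$, let $\zeta\sim\mathcal N(0,I)$ be independent of $\xi$, and let $g=\mathrm{clip}(v+\xi+k\zeta,c)$. Then $$\mathbb{E}_{\xi\sim p,\zeta}[\langle v,g\rangle]\ge\|v\|\min\left\{\|v\|,\frac34c\right\}\mathbb{P}\left(\|k\zeta\|<\frac c4\right)-O\!\left(\frac{\sigma_\xi^2}{k^2}\right),$$ where the implied constant in $O(\cdot)$ does not depend on $k$ or on the distribution of $\xi$.
   Context: For $g\in\mathbb{R}^d$ and $c>0$, $\mathrm{clip}(g,c)=g\cdot\min\left(1,\frac{c}{\|g\|}\right)$ (with $\mathrm{clip}(0,c)=0$). In the paper $v=\nabla f(x_t)$ is the true gradient and $\xi=\xi_t$ the gradient noise; Gaussian noise $k\zeta$ is added before clipping. *)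

(* Defs.v *)
From HB Require Import structures.
From mathcomp Require Import all_boot all_order all_algebra.
From mathcomp Require Import all_classical all_reals all_analysis.
Set Implicit Arguments. Unset Strict Implicit. Unset Printing Implicit Defensive.
Import Order.TTheory GRing.Theory Num.Theory.
Import numFieldNormedType.Exports.
Local Open Scope classical_set_scope.
Local Open Scope ring_scope.

(* Vectors of R^d are represented as d.-tuple R, which carries the product
   (Borel) sigma-algebra of MathComp-Analysis (measurable_tuple). *)
Section vec.
Context {R : realType} {d : nat}.

Definition vadd (u w : d.-tuple R) : d.-tuple R := [tuple tnth u i + tnth w i | i < d].
Definition vscale (a : R) (u : d.-tuple R) : d.-tuple R := [tuple a * tnth u i | i < d].
Definition vdot (u w : d.-tuple R) : R := \sum_(i < d) tnth u i * tnth w i.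
Definition vnorm (u : d.-tuple R) : R := Num.sqrt (vdot u u).

Definition clip (g : d.-tuple R) (c : R) : d.-tuple R :=
  if vnorm g == 0 then vscale 0 g else vscale (Num.min 1 (c / vnorm g)) g.
End vec.

(* Iterated Lebesgue integral over R^n (coordinate by coordinate); for
   nonnegative measurable functions this is the integral w.r.t. the
   n-dimensional Lebesgue measure (Tonelli). *)
Fixpoint iint {R : realType} (n : nat) : (n.-tuple R -> \bar R) -> \bar R :=
  match n return (n.-tuple R -> \bar R) -> \bar R with
  | 0 => fun f => f [tuple]
  | n'.+1 => fun f =>
      (\int[@lebesgue_measure R]_x iint (fun t : n'.-tuple R => f (cons_tuple x t)))%E
  end.

Definition has_density {R : realType} {dT} {T : measurableType dT}
  (P : probability T R) (n : nat) (X : T -> n.-tuple R) (p : n.-tuple R -> R) : Prop :=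
  measurable_fun [set: n.-tuple R] p /\ (forall x, 0 <= p x) /\
  forall B : set (n.-tuple R), measurable B ->
    P (X @^-1` B) = iint (fun x => (p x)%:E * (\1_B x)%:E)%E.

Definition std_gauss_pdf {R : realType} (n : nat) (x : n.-tuple R) : R :=
  \prod_(i < n) normal_pdf 0 1 (tnth x i).

Definition indep_vec {R : realType} {dT} {T : measurableType dT}
  (P : probability T R) (n m : nat) (X : T -> n.-tuple R) (Y : T -> m.-tuple R) : Prop :=
  forall (A : set (n.-tuple R)) (B : set (m.-tuple R)), measurable A -> measurable B ->
    P (X @^-1` A `&` Y @^-1` B) = (P (X @^-1` A) * P (Y @^-1` B))%E.

(* Main.v *)
(** Write [h u = <v, clip u c>], so that [|h| <= M := |v| c], and let [f z = h (v + k z) + M],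
    a nonnegative function bounded by [2 M].

    With [w = xi / k], [E h(v + xi + k zeta) + M] is the mean of [f (zeta + w)], and by the
    Cameron-Martin formula averaging over [zeta] turns the shift by [w] into the weight
    [exp (<z, w> - |w|^2 / 2) >= 1 + <z, w> - |w|^2 / 2].  As [f >= 0], integrating this bound
    against [f] gives [E f(zeta)], plus a term linear in [w], minus at most [M |w|^2]; since [xi]
    is centred, averaging over [xi] loses only [M sigma^2 / k^2], whatever the law of [xi].

    It remains to bound [E h(v + k zeta)] from below.  Clipping is a monotone operator, hence
    [h (v + z) + h (v - z) >= 0] always, and [h (v + z) + h (v - z) >= 2 |v| min (|v|, 3/4 c)]
    when [|z| < c/4]; conclude with the symmetry of [zeta]. *)
Require Import Defs.
From HB Require Import structures.
From mathcomp Require Import all_boot all_order all_algebra.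
From mathcomp Require Import all_classical all_reals all_analysis.
From mathcomp Require Import measurable_realfun ring lra.
Set Implicit Arguments. Unset Strict Implicit. Unset Printing Implicit Defensive.
Import Order.TTheory GRing.Theory Num.Theory.
Import numFieldNormedType.Exports.
Local Open Scope classical_set_scope.
Local Open Scope ring_scope.

(** * Euclidean geometry of tuples and monotonicity of clipping *)

Section vectors.
Context {R : realType} {d : nat}.
Implicit Types (a b c : R) (u v w x y z : d.-tuple R).

Lemma vdotC u w : vdot u w = vdot w u.
Proof. by apply: eq_bigr => i _; rewrite mulrC. Qed.

Lemma vdotDr u w z : vdot u (vadd w z) = vdot u w + vdot u z.
Proof.
by rewrite /vdot -big_split/=; apply: eq_bigr => i _; rewrite tnth_mktuple mulrDr.
Qed.

Lemma vdotZr u a w : vdot u (vscale a w) = a * vdot u w.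
Proof.
by rewrite /vdot mulr_sumr; apply: eq_bigr => i _; rewrite tnth_mktuple mulrCA.
Qed.

Lemma vdotDl u w z : vdot (vadd w z) u = vdot w u + vdot z u.
Proof. by rewrite !(vdotC _ u) vdotDr. Qed.

Lemma vdotZl u a w : vdot (vscale a w) u = a * vdot w u.
Proof. by rewrite !(vdotC _ u) vdotZr. Qed.

Definition vdotE := (vdotDr, vdotDl, vdotZr, vdotZl).

Lemma vdot_ge0 u : 0 <= vdot u u.
Proof. by apply: sumr_ge0 => i _; rewrite -expr2 sqr_ge0. Qed.

Lemma vnorm_ge0 u : 0 <= vnorm u.
Proof. exact: sqrtr_ge0. Qed.

Lemma vnorm_sqr u : vnorm u ^+ 2 = vdot u u.
Proof. by rewrite sqr_sqrtr ?vdot_ge0. Qed.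

Lemma vnorm0_eq u : vnorm u = 0 -> forall i, tnth u i = 0.
Proof.
move=> u0; have /eqP : vdot u u = 0 by rewrite -vnorm_sqr u0 expr0n.
rewrite psumr_eq0 => [/allP h i|i _]; last by rewrite -expr2 sqr_ge0.
by have := h i (mem_index_enum _); rewrite /= -expr2 sqrf_eq0 => /eqP.
Qed.

Lemma vnorm0_vdot u w : vnorm u = 0 -> vdot u w = 0.
Proof. by move=> /vnorm0_eq h; apply: big1 => i _; rewrite h mul0r. Qed.

(** Cauchy-Schwarz; a vector of norm zero is treated apart because the main argument divides by both
    norms. *)
Lemma vdot_le u w : vdot u w <= vnorm u * vnorm w.
Proof.
have [/[dup] u0 /(vnorm0_vdot w) ->|u0] := eqVneq (vnorm u) 0.
  by rewrite u0 mul0r.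
have [/[dup] w0 /(vnorm0_vdot u) wu|w0] := eqVneq (vnorm w) 0.
  by rewrite w0 vdotC wu mulr0.
have {}u0 : 0 < vnorm u by rewrite lt0r u0 vnorm_ge0.
have {}w0 : 0 < vnorm w by rewrite lt0r w0 vnorm_ge0.
(* The squared norm of [|w| u - |u| w] equals [2 |u| |w| (|u| |w| - <u, w>)]. *)
have := vdot_ge0 (vadd (vscale (vnorm w) u) (vscale (- vnorm u) w)).
rewrite !vdotE (vdotC w u) -!vnorm_sqr => h.
have uw : 0 < vnorm u * vnorm w by rewrite mulr_gt0.
nra.
Qed.

Lemma vnorm_scale a u : vnorm (vscale a u) = `|a| * vnorm u.
Proof.
by rewrite /vnorm !vdotE mulrA -expr2 sqrtrM ?sqr_ge0// sqrtr_sqr.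
Qed.

Lemma vnorm_add u w : vnorm (vadd u w) <= vnorm u + vnorm w.
Proof.
rewrite -(@ler_pXn2r _ 2)// ?nnegrE ?addr_ge0 ?vnorm_ge0//.
rewrite sqrrD !vnorm_sqr !vdotE (vdotC w u).
have := vdot_le u w; lra.
Qed.

Lemma vdot_ge u w : - (vnorm u * vnorm w) <= vdot u w.
Proof.
have := vdot_le (vscale (-1) u) w.
by rewrite vnorm_scale vdotE normrN1 mul1r mulN1r lerNl.
Qed.

(** A single scalar covers both branches of [clip], so that inner products with a clipped vector
    expand by bilinearity. *)
Definition clip_coef c u := if vnorm u == 0 then 0 else Num.min 1 (c / vnorm u).

Lemma clipE c u : clip u c = vscale (clip_coef c u) u.
Proof. by rewrite /clip /clip_coef; case: ifP. Qed.

Lemma clip_coef_ge0 c u : 0 < c -> 0 <= clip_coef c u.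
Proof.
move=> c0; rewrite /clip_coef; case: ifP => // _.
by rewrite le_min ler01 divr_ge0 ?vnorm_ge0// ltW.
Qed.

Lemma clip_coef_norm c u : 0 < c -> clip_coef c u * vnorm u = Num.min (vnorm u) c.
Proof.
move=> c0; rewrite /clip_coef; case: eqP => [->|/eqP u0].
  by rewrite mul0r minEle ltW.
by rewrite minr_pMl ?vnorm_ge0// mul1r divfK.
Qed.

Lemma vnorm_clip c u : 0 < c -> vnorm (clip u c) = Num.min (vnorm u) c.
Proof.
by move=> c0; rewrite clipE vnorm_scale ger0_norm ?clip_coef_ge0// clip_coef_norm.
Qed.

Lemma vdot_clip_small c u v : 0 < c -> vnorm u <= c -> vdot v (clip u c) = vdot v u.
Proof.
move=> c0 uc; rewrite clipE vdotE /clip_coef; case: eqP => [u0|/eqP u0].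
  by rewrite vdotC vnorm0_vdot// mulr0.
by rewrite minEle ler_pdivlMr ?lt0r ?u0 ?vnorm_ge0// mul1r uc mul1r.
Qed.

Lemma vdot_clip_le c u v : 0 < c -> `|vdot v (clip u c)| <= vnorm v * c.
Proof.
move=> c0; have h : vnorm v * vnorm (clip u c) <= vnorm v * c.
  by rewrite ler_wpM2l ?vnorm_ge0// vnorm_clip// ge_min lexx orbT.
rewrite ler_norml (le_trans (vdot_le _ _) h) andbT.
by apply: le_trans (vdot_ge _ _); rewrite lerN2.
Qed.

(** Let [a], [b] be the two coefficients. By Cauchy-Schwarz, [<a x - b y, x - y>] is at least
    [(a |x| - b |y|) (|x| - |y|)]. Since [a |x| = min (|x|, c)] is nondecreasing in [|x|], and
    likewise for [y], both factors agree in sign. *)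
Lemma clip_monotone c x y : 0 < c ->
  0 <= vdot (vadd (clip x c) (vscale (-1) (clip y c))) (vadd x (vscale (-1) y)).
Proof.
move=> c0; rewrite !clipE !vdotE (vdotC y x) -!vnorm_sqr.
have a0 := clip_coef_ge0 x c0; have b0 := clip_coef_ge0 y c0.
have /(ler_wpM2l (addr_ge0 a0 b0)) hxy := vdot_le x y.
have : 0 <= (Num.min (vnorm x) c - Num.min (vnorm y) c) * (vnorm x - vnorm y).
  have [xy|/ltW xy] := leP (vnorm x) (vnorm y).
    by rewrite mulr_le0// subr_le0// le_min2.
  by rewrite mulr_ge0// subr_ge0// le_min2.
rewrite -!clip_coef_norm//; lra.
Qed.

(** Monotonicity of clipping along the line [z + R v]: the two points differ by [(t - s) v], and for
    [s < t] the positive factor [t - s] can be divided out. *)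
Lemma vdot_clip_shift_ge c v z s t : 0 < c -> s <= t ->
  vdot v (clip (vadd (vscale s v) z) c) <= vdot v (clip (vadd (vscale t v) z) c).
Proof.
move=> c0; rewrite le_eqVlt => /predU1P[->//|st].
have := clip_monotone (vadd (vscale t v) z) (vadd (vscale s v) z) c0.
rewrite !vdotE !(vdotC (clip _ _)).
rewrite (vdotC z) (vdotC z).
have : 0 < t - s by rewrite subr_gt0.
set p := vdot v (clip _ _); set q := vdot v (clip _ _).
move=> ts h; rewrite -subr_ge0 -(pmulr_rge0 _ ts); move: h.
lra.
Qed.

End vectors.

(** * Integration against a measure given by a density *)

Section density.
Local Open Scope ereal_scope.
Context {dT} {T : measurableType dT} {R : realType}.
Variables (mu nu : {measure set T -> \bar R}) (p : T -> R).
Hypotheses (mp : measurable_fun setT p) (p0 : forall x, (0 <= p x)%R).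
Hypothesis nuE : forall A, measurable A -> nu A = \int[mu]_(x in A) (p x)%:E.

Import HBNNSimple.

Let integral_density_nnsfun (f : {nnsfun T >-> R}) :
  \int[nu]_x (f x)%:E = \int[mu]_x ((f x)%:E * (p x)%:E).
Proof.
under [LHS]eq_integral do rewrite fimfunE -fsumEFin//.
rewrite [LHS]ge0_integral_fsum//; last 2 first.
  - by move=> r; exact/measurable_EFinP/measurableT_comp.
  - by move=> n x _; rewrite EFinM nnfun_muleindic_ge0.
under [RHS]eq_integral.
  move=> x xD; rewrite fimfunE -fsumEFin// muleC ge0_mule_fsumr; last first.
    move=> r. by rewrite EFinM nnfun_muleindic_ge0.
  over.
rewrite [RHS]ge0_integral_fsum//; last 2 first.
  - move=> r; apply: emeasurable_funM; first exact/measurable_EFinP.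
    by apply/measurable_EFinP; do 2 apply/measurableT_comp => //.
  - by move=> n x _; rewrite mule_ge0 1?EFinM ?nnfun_muleindic_ge0 ?lee_fin.
apply: eq_fsbigr => r _; rewrite integralZl_indic_nnsfun// integral_indic//.
rewrite setIT nuE// integral_mkcond.
(* A nonnegative simple function does not take a negative value [r], so both sides vanish; otherwise
   [r] can be moved into the integral. *)
have [r0|r0] := ltP r 0%R.
  rewrite preimage_nnfun0//; under eq_integral do rewrite patch_set0.
  rewrite integral0 mule0; under eq_integral do rewrite indic0 mulr0 mule0.
  by rewrite integral0.
rewrite -ge0_integralZl//.
- apply: eq_integral => x _; rewrite patchE indicE.
  by case: ifP => _; rewrite ?mulr1 ?mulr0 ?mule0// muleC.
- apply/(measurable_restrictT _ _).1 => //.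
  exact/measurable_EFinP/measurable_funTS.
- by move=> x _; rewrite patchE; case: ifP; rewrite ?lee_fin.
Qed.

(** Monotone convergence, from simple functions increasing to [f], applied on both sides. *)
Lemma ge0_integral_density (f : T -> \bar R) :
  measurable_fun setT f -> (forall x, 0 <= f x) ->
  \int[nu]_x f x = \int[mu]_x (f x * (p x)%:E).
Proof.
move=> mf f0; pose f_ := nnsfun_approx measurableT mf.
have fE x : f x = lim ((f_ n x)%:E @[n --> \oo]).
  by apply/esym/cvg_lim => //; exact: cvg_nnsfun_approx.
have f_nd x m n : (m <= n)%N -> (f_ m x <= f_ n x)%R.
  by move=> mn; exact/lefP/nd_nnsfun_approx.
have mp' : measurable_fun setT (EFin \o p) by exact/measurable_EFinP.
under eq_integral do rewrite fE.
rewrite monotone_convergence//=; first last.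
- by move=> x _ m n mn; rewrite lee_fin f_nd.
- by move=> n x _; rewrite lee_fin.
- by move=> n; exact/measurable_EFinP/measurable_funTS.
transitivity (\int[mu]_x lim (((f_ n x)%:E * (p x)%:E) @[n --> \oo])).
  rewrite monotone_convergence//=.
  - by apply: congr_lim; apply/funext => n; exact: integral_density_nnsfun.
  - by move=> n; apply: emeasurable_funM => //; exact/measurable_EFinP.
  - by move=> n x _; rewrite mule_ge0 ?lee_fin.
  - by move=> x _ m n mn; rewrite lee_wpmul2r ?lee_fin// f_nd.
apply: eq_integral => x _; rewrite fE limeMr//.
apply/ereal_nondecreasing_is_cvgn => m n mn.
by rewrite lee_fin f_nd.
Qed.

End density.

(** * Invariance of Lebesgue measure under translation and reflection *)

Section translation.
Local Open Scope ereal_scope.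
Context {R : realType}.
Notation mu := (@lebesgue_measure R).

Let shift (a : R) (x : measurableTypeR R) : measurableTypeR R := (x + a)%R.

Let mshift a : measurable_fun setT (shift a).
Proof. exact: measurable_funD. Qed.

(** Lebesgue measure is determined by its values on half-open intervals, and translation preserves
    their lengths. *)
Lemma lebesgue_measure_shift (a : R) (A : set R) : measurable A ->
  pushforward mu (shift a) A = mu A.
Proof.
move=> mA; apply/esym/lebesgue_measure_unique => //=.
move=> _ [[b c]] _ <-.
rewrite /pushforward/=.
have -> : shift a @^-1` `]b, c] = `](b - a)%R, (c - a)%R]%classic.
  by apply/seteqP; split => x /=; rewrite !in_itv/= ltrBlDr lerBrDr.
rewrite !lebesgue_measure_itv/= !lte_fin ltrD2r; case: ifP => // _.
by rewrite -!EFinD; congr EFin; ring.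
Qed.

Lemma ge0_integral_shift (a : R) (f : R -> \bar R) :
  measurable_fun setT f -> (forall x, 0 <= f x) ->
  \int[mu]_x f (x + a)%R = \int[mu]_x f x.
Proof.
move=> mf f0.
rewrite -[LHS]/(\int[mu]_(x in shift a @^-1` setT) (f \o shift a) x).
rewrite -(ge0_integral_pushforward (mshift a))//.
by apply: eq_measure_integral => B mB _; exact: lebesgue_measure_shift.
Qed.

Lemma ge0_integral_opp (f : R -> \bar R) :
  measurable_fun setT f -> (forall x, 0 <= f x) ->
  \int[mu]_x f (- x)%R = \int[mu]_x f x.
Proof.
move=> mf f0.
transitivity (\int[pushforward mu
  (-%R : measurableTypeR R -> measurableTypeR R)]_x f x).
  by rewrite ge0_integral_pushforward.
by apply: eq_measure_integral => //= B mB _; exact: lebesgue_measureN.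
Qed.

End translation.

(** * Symmetry and shift formula of the one-dimensional standard normal law *)

Section normal1.
Local Open Scope ereal_scope.
Context {R : realType}.
Notation N1 := (normal_prob (0 : R) 1).
Notation phi := (normal_pdf (0 : R) 1).

Lemma integral_normal_prob (m s : R) (f : R -> \bar R) :
  measurable_fun setT f -> (forall x, 0 <= f x) ->
  \int[normal_prob m s]_x f x = \int[lebesgue_measure]_x (f x * (normal_pdf m s x)%:E).
Proof.
move=> mf f0; apply: ge0_integral_density => //.
  exact: measurable_normal_pdf.
exact: normal_pdf_ge0.
Qed.

Let pdf_mul_ge0 f : (forall x, 0 <= f x) -> forall x, 0 <= f x * (phi x)%:E.
Proof. by move=> f0 x; rewrite mule_ge0// lee_fin normal_pdf_ge0. Qed.

Let pdf_mul_measurable (f : R -> \bar R) : measurable_fun setT f ->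
  measurable_fun setT (fun x : R => f x * (phi x)%:E).
Proof.
move=> mf; apply: emeasurable_funM => //; apply/measurable_EFinP.
exact: measurable_normal_pdf.
Qed.

Lemma std_normal_opp (f : R -> \bar R) :
  measurable_fun setT f -> (forall x, 0 <= f x) ->
  \int[N1]_x f (- x)%R = \int[N1]_x f x.
Proof.
move=> mf f0; have mfN : measurable_fun setT (fun x : R => f (- x)%R).
  exact: measurableT_comp.
rewrite (integral_normal_prob _ _ mf f0) (integral_normal_prob _ _ mfN)//.
rewrite -(ge0_integral_opp (pdf_mul_measurable mf) (pdf_mul_ge0 f0)).
apply: eq_integral => x _; congr (_ * _%:E).
by rewrite !normal_pdfE ?oner_neq0// /normal_fun !subr0 sqrrN.
Qed.

(** One-dimensional Cameron-Martin formula. Completing the square gives [phi x = exp ((x + a) a -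
    a^2 / 2) * phi (x + a)]; then translate the Lebesgue integral. *)
Lemma std_normal_shift (a : R) (f : R -> \bar R) :
  measurable_fun setT f -> (forall x, 0 <= f x) ->
  \int[N1]_x f (x + a)%R = \int[N1]_x (f x * (expR (x * a - a * a / 2))%:E).
Proof.
move=> mf f0; have mfa : measurable_fun setT (fun x : R => f (x + a)%R).
  by apply: measurableT_comp => //; exact: measurable_funD.
pose g (x : R) := f x * (expR (x * a - a * a / 2))%:E.
have mg : measurable_fun setT g.
  apply: emeasurable_funM => //; apply/measurable_EFinP/measurableT_comp => //.
  by apply: measurable_funB => //; exact: measurable_funM.
have g0 x : 0 <= g x by rewrite mule_ge0// lee_fin expR_ge0.
rewrite (integral_normal_prob _ _ mfa)// (integral_normal_prob _ _ mg)//.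
rewrite -(ge0_integral_shift a (pdf_mul_measurable mg) (pdf_mul_ge0 g0)).
apply: eq_integral => x _; rewrite -muleA; congr (_ * _).
rewrite -EFinM; congr EFin.
rewrite !normal_pdfE ?oner_neq0// /normal_fun mulrCA -expRD; congr (_ * expR _)%R.
by field.
Qed.

End normal1.

(** * Measurability of the vector operations and of clipping *)

Section vector_measurability.
Context {R : realType} {dT} {T : measurableType dT} {d : nat}.
Implicit Types f g : T -> d.-tuple R.

Lemma measurable_tnth_comp f i : measurable_fun setT f ->
  measurable_fun setT (fun x => tnth (f x) i).
Proof. by move=> mf; apply: (measurableT_comp (measurable_tnth i)). Qed.

Lemma measurable_vadd f g : measurable_fun setT f -> measurable_fun setT g ->
  measurable_fun setT (fun x => vadd (f x) (g x)).
Proof.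
move=> mf mg; apply/measurable_fun_tnthP => i.
rewrite (_ : _ \o _ = fun x => tnth (f x) i + tnth (g x) i).
  by apply: measurable_funD; exact: measurable_tnth_comp.
by apply/funext => x /=; rewrite tnth_mktuple.
Qed.

Lemma measurable_vscale (a : T -> R) f : measurable_fun setT a ->
  measurable_fun setT f -> measurable_fun setT (fun x => vscale (a x) (f x)).
Proof.
move=> ma mf; apply/measurable_fun_tnthP => i.
rewrite (_ : _ \o _ = fun x => a x * tnth (f x) i).
  by apply: measurable_funM => //; exact: measurable_tnth_comp.
by apply/funext => x /=; rewrite tnth_mktuple.
Qed.

Lemma measurable_vdot f g : measurable_fun setT f -> measurable_fun setT g ->
  measurable_fun setT (fun x => vdot (f x) (g x)).
Proof.
move=> mf mg; apply: measurable_sum => i.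
by apply: measurable_funM; exact: measurable_tnth_comp.
Qed.

Lemma measurable_vnorm f : measurable_fun setT f ->
  measurable_fun setT (fun x => vnorm (f x)).
Proof.
move=> mf; have mff := measurable_vdot mf mf.
(* The square root of a nonnegative real is its power 1/2, and powers are measurable; the inverse of
   the norm is handled likewise in [measurable_clip]. *)
under eq_fun do rewrite /vnorm -powR12_sqrt ?vdot_ge0//.
exact: (measurableT_comp (measurable_powR _)).
Qed.

Lemma measurable_clip f c : measurable_fun setT f ->
  measurable_fun setT (fun x => clip (f x) c).
Proof.
move=> mf; have mn := measurable_vnorm mf.
apply: measurable_fun_ifT.
- by apply: measurable_fun_eqr => //.
- exact: measurable_vscale.
- apply: measurable_vscale => //; apply: measurable_minr => //.
  apply: measurable_funM => //.
  under eq_fun do rewrite -powR_inv1 ?vnorm_ge0//.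
  exact: (measurableT_comp (measurable_powR _)).
Qed.

End vector_measurability.

(** * The standard Gaussian measure on tuples and its Cameron-Martin formula *)

Section gauss.
Context {R : realType}.
Local Open Scope ereal_scope.
Notation N1 := (normal_prob (0 : R) 1).

Definition consp n (xt : measurableTypeR R * n.-tuple R) : n.+1.-tuple R :=
  cons_tuple (xt.1 : R) xt.2.

Lemma measurable_consp n : measurable_fun setT (@consp n).
Proof. by apply: measurable_cons; [exact: measurable_fst|exact: measurable_snd]. Qed.

HB.instance Definition _ n := isMeasurableFun.Build _ _ _ _ _ (@measurable_consp n).

(** Built by adding one coordinate at a time, in the same order as [iint], so that facts about it
    follow by induction on the dimension from the one-dimensional case and Tonelli. *)
Fixpoint gauss (n : nat) : probability (n.-tuple R) R :=
  match n with
  | 0 => dirac [tuple]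
  | n'.+1 => distribution (N1 \x gauss n') (@consp n')
  end.

Lemma integral_gaussS n (f : n.+1.-tuple R -> \bar R) :
  measurable_fun setT f -> (forall t, 0 <= f t) ->
  \int[gauss n.+1]_t f t = \int[N1]_x \int[gauss n]_t f (cons_tuple x t).
Proof.
move=> mf f0; rewrite ge0_integral_distribution//.
rewrite (fubini_tonelli1 (f \o @consp n))//.
  exact: measurableT_comp.
by move=> x; exact: f0.
Qed.

Lemma gaussS n (B : set (n.+1.-tuple R)) : measurable B ->
  gauss n.+1 B = \int[N1]_x gauss n [set t | B (cons_tuple x t)].
Proof.
move=> mB; rewrite /= /distribution /pushforward.
rewrite /product_measure1; apply: eq_integral => x _ /=.
by congr (gauss n _); apply/seteqP; split => t; rewrite /xsection/= inE.
Qed.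

Lemma measurable_cons_section n (B : set (n.+1.-tuple R)) x : measurable B ->
  measurable [set t | B (cons_tuple x t)].
Proof.
move=> mB; have mx : measurable_fun setT (fun t : n.-tuple R => cons_tuple x t).
  apply: measurable_cons; [exact: measurable_cst|exact: measurable_id].
by rewrite -[X in measurable X]setTI; exact: mx.
Qed.

Lemma measurable_fun_gauss_section n (B : set (n.+1.-tuple R)) : measurable B ->
  measurable_fun setT (fun x : R => gauss n [set t | B (cons_tuple x t)]).
Proof.
move=> mB; have mC : measurable (@consp n @^-1` B).
  by rewrite -[X in measurable X]setTI; exact: measurable_consp.
have := measurable_fun_xsection (gauss n) mC.
congr (measurable_fun _ _); apply/funext => x /=.
by congr (gauss n _); apply/seteqP; split => t; rewrite /xsection/= inE.
Qed.

(** The factor [a] makes the induction work: once the first coordinate [x] is fixed, its density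
    value [normal_pdf 0 1 x] is absorbed into the constant. *)
Lemma iint_std_gauss_pdf n (a : R) (B : set (n.-tuple R)) :
  measurable B -> (0 <= a)%R ->
  iint (fun x => (a * std_gauss_pdf x)%:E * (\1_B x)%:E) = a%:E * gauss n B.
Proof.
elim: n a B => [|n IH] a B mB a0.
  by rewrite /= /std_gauss_pdf big_ord0 mulr1.
rewrite gaussS// integral_normal_prob//; last exact: measurable_fun_gauss_section.
rewrite -ge0_integralZl//.
- rewrite /=; apply: eq_integral => x _.
  rewrite muleCA -EFinM muleC -IH.
  + congr iint; apply/funext => t; rewrite /std_gauss_pdf big_ord_recl tnth0 !mulrA.
    rewrite !indicE; congr ((_ * _)%:E * _).
    by apply: eq_bigr => i _; rewrite tnthS.
  + exact: measurable_cons_section.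
  + by rewrite mulr_ge0// normal_pdf_ge0.
- apply: emeasurable_funM; first exact: measurable_fun_gauss_section.
  by apply/measurable_EFinP; exact: measurable_normal_pdf.
- by move=> x _; rewrite mule_ge0// lee_fin normal_pdf_ge0.
Qed.

(** Used to replace the law of [zeta], known through iterated integrals, by the measure [gauss]. *)
Lemma has_density_std_gauss dT (T : measurableType dT) (P : probability T R) n
    (Z : T -> n.-tuple R) (B : set (n.-tuple R)) :
  has_density P Z (@std_gauss_pdf R n) -> measurable B ->
  P (Z @^-1` B) = gauss n B.
Proof.
move=> [_ [_ PZ]] mB; rewrite PZ// -[RHS]mul1e -iint_std_gauss_pdf//.
by congr iint; apply/funext => x; rewrite mul1r.
Qed.

Lemma measurable_integral_gauss_section n (f : n.+1.-tuple R -> \bar R) :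
  measurable_fun setT f -> (forall t, 0 <= f t) ->
  measurable_fun setT (fun x : R => \int[gauss n]_t f (cons_tuple x t)).
Proof.
move=> mf f0; apply: (measurable_fun_fubini_tonelli_F (f \o @consp n)).
  exact: measurableT_comp.
by move=> x; exact: f0.
Qed.

Lemma measurable_comp_cons n (f : n.+1.-tuple R -> \bar R) x :
  measurable_fun setT f ->
  measurable_fun setT (fun t : n.-tuple R => f (cons_tuple x t)).
Proof.
move=> mf; apply: measurableT_comp => //.
by apply: measurable_cons; [exact: measurable_cst|exact: measurable_id].
Qed.

Lemma vscale_cons n a x (t : n.-tuple R) :
  vscale a (cons_tuple x t) = cons_tuple (a * x)%R (vscale a t).
Proof.
apply: eq_from_tnth => i; rewrite tnth_mktuple.
by case: (unliftP ord0 i) => [j|] ->; rewrite ?tnthS ?tnth0// tnth_mktuple.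
Qed.

Lemma vadd_cons n x y (t u : n.-tuple R) :
  vadd (cons_tuple x t) (cons_tuple y u) = cons_tuple (x + y)%R (vadd t u).
Proof.
apply: eq_from_tnth => i; rewrite tnth_mktuple.
by case: (unliftP ord0 i) => [j|] ->; rewrite ?tnthS ?tnth0// tnth_mktuple.
Qed.

Lemma vdot_cons n x y (t u : n.-tuple R) :
  vdot (cons_tuple x t) (cons_tuple y u) = (x * y + vdot t u)%R.
Proof.
rewrite /vdot big_ord_recl !tnth0; congr (_ + _)%R.
by apply: eq_bigr => i _; rewrite !tnthS.
Qed.

Lemma integral_gauss_opp n (f : n.-tuple R -> \bar R) :
  measurable_fun setT f -> (forall t, 0 <= f t) ->
  \int[gauss n]_t f (vscale (-1) t) = \int[gauss n]_t f t.
Proof.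
elim: n f => [|n IH] f mf f0.
  by apply: eq_integral => t _; rewrite [t]tuple0 [vscale _ _]tuple0.
have mfN : measurable_fun setT (fun t => f (vscale (-1) t)).
  by apply: measurableT_comp => //; exact: measurable_vscale.
rewrite !integral_gaussS//.
rewrite -(std_normal_opp (measurable_integral_gauss_section mf f0)); last first.
  by move=> x; exact: (integral_ge0 (gauss n) (fun t _ => f0 (cons_tuple x t))).
apply: eq_integral => x _; rewrite -(IH _ (measurable_comp_cons (- x)%R mf))//.
by apply: eq_integral => t _; rewrite vscale_cons mulN1r.
Qed.

(** The density at [t] of the law N(w, I) with respect to N(0, I). *)
Definition gauss_weight n (w t : n.-tuple R) : R := expR (vdot t w - vdot w w / 2).

Lemma gauss_weight_ge0 n (w t : n.-tuple R) : (0 <= gauss_weight w t)%R.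
Proof. exact: expR_ge0. Qed.

Lemma measurable_gauss_weight n (w : n.-tuple R) :
  measurable_fun setT (fun t => (gauss_weight w t)%:E).
Proof.
apply/measurable_EFinP/measurableT_comp => //; apply: measurable_funB => //.
exact: measurable_vdot.
Qed.

(** Cameron-Martin formula, by induction on the dimension: the weight is a product of
    one-dimensional weights over the coordinates. *)
Lemma integral_gauss_shift n (w : n.-tuple R) (f : n.-tuple R -> \bar R) :
  measurable_fun setT f -> (forall t, 0 <= f t) ->
  \int[gauss n]_t f (vadd t w) = \int[gauss n]_t (f t * (gauss_weight w t)%:E).
Proof.
elim: n w f => [|n IH] w f mf f0.
  apply: eq_integral => t _; rewrite /gauss_weight /vdot !big_ord0 mul0r subr0 expR0 mule1.
  by rewrite [t]tuple0 [vadd _ _]tuple0.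
have mfw : measurable_fun setT (fun t => f (vadd t w)).
  by apply: measurableT_comp => //; exact: measurable_vadd.
have mfe : measurable_fun setT (fun t => f t * (gauss_weight w t)%:E).
  by apply: emeasurable_funM => //; exact: measurable_gauss_weight.
have fe0 t : 0 <= f t * (gauss_weight w t)%:E.
  by rewrite mule_ge0// lee_fin gauss_weight_ge0.
rewrite !integral_gaussS//.
case/tupleP: w => a w in mfw mfe fe0 *.
(* [g] carries only the weight of the tail coordinates, supplied by the induction hypothesis; the
   factor of the first coordinate then comes from [std_normal_shift]. *)
pose g t := f t * (gauss_weight w (behead_tuple t))%:E.
have mg : measurable_fun setT g.
  apply: emeasurable_funM => //.
  apply: (measurableT_comp (measurable_gauss_weight w)).
  exact: measurable_behead.
have g0 t : 0 <= g t by rewrite mule_ge0// lee_fin gauss_weight_ge0.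
have gE x t : g (cons_tuple x t) = f (cons_tuple x t) * (gauss_weight w t)%:E.
  by congr (_ * (gauss_weight w _)%:E); exact: val_inj.
transitivity (\int[N1]_x \int[gauss n]_t g (cons_tuple (x + a)%R t)).
  apply: eq_integral => x _; under [RHS]eq_integral do rewrite gE.
  rewrite -(IH _ _ (measurable_comp_cons (x + a)%R mf))//.
  by apply: eq_integral => t _; rewrite vadd_cons.
rewrite (std_normal_shift a (measurable_integral_gauss_section mg g0)); last first.
  by move=> x; exact: (integral_ge0 (gauss n) (fun t _ => g0 (cons_tuple x t))).
apply: eq_integral => x _.
rewrite -(ge0_integralZr (gauss n) measurableT (measurable_comp_cons x mg)); first last.
- by rewrite lee_fin expR_ge0.
- by move=> t _; exact: g0.
apply: eq_integral => t _; rewrite gE -muleA -EFinM -expRD /gauss_weight.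
by rewrite !vdot_cons; congr (_ * (expR _)%:E); field.
Qed.

End gauss.

(** * Integrability under the Gaussian and the smoothing bound *)

Section smoothing.
Context {R : realType} {n : nat}.
Local Open Scope ereal_scope.
Notation G := (@gauss R n).

(** The shift formula applied to the constant function 1. *)
Lemma integral_gauss_weight (w : n.-tuple R) : \int[G]_t (gauss_weight w t)%:E = 1.
Proof.
have := @integral_gauss_shift R n w (cst 1) (measurable_cst _) (fun=> lee01).
have -> : \int[G]_t cst 1 (vadd t w) = 1.
  by rewrite (integral_cst G measurableT 1) mul1e; exact: probability_setT.
by move=> ->; apply: eq_integral => t _; rewrite mul1e.
Qed.

Lemma integrable_gauss_weight (w : n.-tuple R) :
  G.-integrable setT (fun t => (gauss_weight w t)%:E).
Proof.
apply/integrableP; split; first exact: measurable_gauss_weight.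
under eq_integral do rewrite gee0_abs ?lee_fin ?gauss_weight_ge0//.
by rewrite integral_gauss_weight ltry.
Qed.

Let basis (i : 'I_n) : n.-tuple R := [tuple (j == i)%:R | j < n].

Let vdot_basis t i : vdot t (basis i) = tnth t i.
Proof.
rewrite /vdot (bigD1 i)//= tnth_mktuple eqxx mulr1 big1 ?addr0// => j /negbTE ji.
by rewrite tnth_mktuple ji mulr0.
Qed.

(** The weights of the shifts by plus and minus the [i]-th basis vector are integrable, and their
    sum dominates the absolute value of the coordinate because [exp (s - 1/2) >= s + 1/2]. *)
Lemma integrable_gauss_tnth (i : 'I_n) : G.-integrable setT (fun t => (tnth t i)%:E).
Proof.
apply: (le_integrable measurableT _ _ (integrableD measurableT
  (integrable_gauss_weight (basis i))
  (integrable_gauss_weight (vscale (-1) (basis i))))).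
  by apply/measurable_EFinP; exact: measurable_tnth.
move=> t _ /=; rewrite lee_fin [leRHS]ger0_norm; last by rewrite addr_ge0 ?gauss_weight_ge0.
rewrite /gauss_weight !vdotE !vdot_basis tnth_mktuple eqxx.
have := expR_ge1Dx (tnth t i - 1 / 2).
have := expR_ge1Dx (-1 * tnth t i - -1 * (-1 * 1) / 2).
have := expR_ge0 (tnth t i - 1 / 2).
have := expR_ge0 (-1 * tnth t i - -1 * (-1 * 1) / 2).
rewrite ler_norml; lra.
Qed.

Lemma integrable_bounded_mul (f g : n.-tuple R -> R) (K : R) :
  measurable_fun setT f -> (forall t, `|f t| <= K)%R ->
  G.-integrable setT (EFin \o g) -> G.-integrable setT (fun t => (f t * g t)%:E).
Proof.
move=> mf fK ig.
have mg : measurable_fun setT g by apply/measurable_EFinP; exact: measurable_int ig.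
apply: (le_integrable measurableT _ _ (integrableZl measurableT K ig)).
  by apply/measurable_EFinP; exact: measurable_funM.
move=> t _ /=; rewrite lee_fin !normrM ler_wpM2r//.
by rewrite (le_trans (fK t))// ler_norm.
Qed.

(* Since [expR x >= 1 + x], the Cameron-Martin weight is bounded below by a
   quadratic; multiplying by [f >= 0] and integrating gives the bound. *)
Lemma gauss_smoothing_ge (f : n.-tuple R -> R) (K : R) :
  measurable_fun setT f -> (forall t, 0 <= f t <= K)%R ->
  exists b : n.-tuple R, forall w,
    \int[G]_t (f t)%:E + (vdot b w - K / 2 * vdot w w)%:E
      <= \int[G]_t (f (vadd t w))%:E.
Proof.
move=> mf f0K.
have f0 t : (0 <= f t)%R by case/andP: (f0K t).
have fK t : (f t <= K)%R by case/andP: (f0K t).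
have nfK t : (`|f t| <= K)%R by rewrite ger0_norm.
have if1 : G.-integrable setT (EFin \o f).
  have := @integrable_bounded_mul f (cst 1%R) K mf nfK
    (finite_measure_integrable_cst G 1%R measurableT).
  by apply: eq_integrable => // t _; rewrite /= mulr1.
have ifz i : G.-integrable setT (fun t => (f t * tnth t i)%:E).
  exact: (integrable_bounded_mul mf nfK (integrable_gauss_tnth i)).
(* [b] is the mean of [f(t) t], with finite entries by [ifz]. It is chosen before [w], so the
   correction [<b, w>] is truly linear in [w]. *)
pose b := [tuple fine (\int[G]_t (f t * tnth t i)%:E) | i < n].
exists b => w.
have ifzw i : G.-integrable setT (fun t => (tnth w i)%:E * (f t * tnth t i)%:E).
  exact: integrableZl.
have ifsum : G.-integrable setT (fun t => (f t * vdot t w)%:E).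
  have := @integrable_sum _ _ _ G _ measurableT _ (index_enum 'I_n) xpredT _ (fun i _ => ifzw i).
  apply: eq_integrable => // t _; rewrite /vdot mulr_sumr -sumEFin.
  by apply: eq_bigr => i _; rewrite -EFinM; congr EFin; ring.
have fsum : \int[G]_t (f t * vdot t w)%:E = (vdot b w)%:E.
  transitivity (\int[G]_t \sum_(i < n) ((tnth w i)%:E * (f t * tnth t i)%:E)).
    apply: eq_integral => t _; rewrite /vdot mulr_sumr -sumEFin.
    by apply: eq_bigr => i _; rewrite -EFinM; congr EFin; ring.
  rewrite integral_sum// /vdot -sumEFin; apply: eq_bigr => i _.
  have bi : (tnth b i)%:E = \int[G]_t (f t * tnth t i)%:E.
    rewrite tnth_mktuple fineK//.
    exact: (integrable_fin_num measurableT (ifz i)).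
  rewrite EFinM bi.
  rewrite muleC.
  exact: (integralZl measurableT (ifz i)).
pose s := (vdot w w / 2)%R.
have s0 : (0 <= s)%R by rewrite divr_ge0 ?vdot_ge0.
have iconst : G.-integrable setT (fun t => (s * f t)%:E) by exact: integrableZl if1.
have mfw : measurable_fun setT (EFin \o f) by exact/measurable_EFinP.
rewrite (integral_gauss_shift w mfw)//.
have iR : G.-integrable setT (fun t => (f t)%:E + (f t * vdot t w)%:E - (s * f t)%:E).
  by apply: integrableB => //; exact: integrableD.
have -> : \int[G]_t (f t)%:E = (fine (\int[G]_t (f t)%:E))%:E.
  by rewrite fineK//; exact: integrable_fin_num.
set A := fine _.
(* The quadratic term costs [A |w|^2 / 2]; bounding the mean [A] by [K] gives the stated
   constant. *)
have AK : (A <= K)%R.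
  rewrite -lee_fin /A fineK; last exact: integrable_fin_num.
  have <- : \int[G]_t (cst K%:E t) = K%:E.
    rewrite (integral_cst G measurableT K%:E) -[RHS]mule1; congr (_ * _).
    exact: probability_setT.
  apply: le_integral => //; first exact: finite_measure_integrable_cst.
  by move=> t _; rewrite lee_fin.
apply: (@le_trans _ _ (\int[G]_t ((f t)%:E + (f t * vdot t w)%:E - (s * f t)%:E))).
  rewrite integralB//; last exact: integrableD.
  rewrite integralD// fsum.
  have -> : \int[G]_t (s * f t)%:E = s%:E * \int[G]_t (f t)%:E by rewrite -integralZl.
  have -> : \int[G]_t (f t)%:E = A%:E by rewrite fineK//; exact: integrable_fin_num.
  rewrite -EFinM -EFinN -!EFinD lee_fin.
  by have := ler_wpM2l s0 AK; rewrite /s; lra.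
have iRw : G.-integrable setT (fun t => (f t * gauss_weight w t)%:E).
  exact: (integrable_bounded_mul mf nfK (integrable_gauss_weight w)).
apply: le_integral => // t _.
rewrite /= lee_fin.
have := ler_wpM2l (f0 t) (expR_ge1Dx (vdot t w - vdot w w / 2)).
rewrite /gauss_weight /s; lra.
Qed.


End smoothing.

(** * Lower bound for clipping under Gaussian noise alone *)

Section clip_gauss.
Context {R : realType} {d : nat}.
Implicit Types (c k : R) (v z : d.-tuple R).

Lemma vscaleA a b z : vscale a (vscale b z) = vscale (a * b) z.
Proof. by apply: eq_from_tnth => i; rewrite !tnth_mktuple mulrA. Qed.

Lemma vscale1 z : vscale 1 z = z.
Proof. by apply: eq_from_tnth => i; rewrite tnth_mktuple mul1r. Qed.

Lemma vdot_clip_opp c v z : vdot v (clip (vscale (-1) z) c) = - vdot v (clip z c).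
Proof.
by rewrite !clipE /clip_coef !vnorm_scale normrN1 mul1r !vdotE mulN1r mulrN.
Qed.

(** Clipping is odd, so the second term is minus the value at [- v + z], and moving from [- v + z]
    to [v + z] cannot decrease the inner product with [v]. *)
Lemma vdot_clip_antipodal_ge0 c v z : 0 < c ->
  0 <= vdot v (clip (vadd v z) c) + vdot v (clip (vadd v (vscale (-1) z)) c).
Proof.
move=> c0; have N11 : (-1 : R) <= 1 by lra.
have := vdot_clip_shift_ge v z c0 N11; rewrite vscale1.
have -> : vadd (vscale (-1) v) z = vscale (-1) (vadd v (vscale (-1) z)).
  by apply: eq_from_tnth => i; rewrite !tnth_mktuple; ring.
rewrite vdot_clip_opp; lra.
Qed.

(* By monotonicity [v] may be shortened to length at most [3/4 * c], after
   which a noise of norm at most [c / 4] leaves the clipping inactive. *)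
Lemma vdot_clip_small_noise c v z : 0 < c -> vnorm z < c / 4 ->
  vnorm v * Num.min (vnorm v) (3 / 4 * c) + vdot v z <= vdot v (clip (vadd v z) c).
Proof.
move=> c0 zc; have [v0|v0] := eqVneq (vnorm v) 0.
  by rewrite !(vnorm0_vdot _ v0) v0 mul0r addr0.
have vp : 0 < vnorm v by rewrite lt0r v0 vnorm_ge0.
(* The shrinking factor for which [t v] has norm [min (|v|, 3/4 c)]; then [t v + z] has norm at most
   [3/4 c + c/4 = c]. *)
pose t := Num.min 1 (3 / 4 * c / vnorm v).
have tv : t * vnorm v = Num.min (vnorm v) (3 / 4 * c).
  by rewrite /t minr_pMl ?vnorm_ge0// mul1r divfK.
have t0 : 0 <= t by rewrite le_min ler01 !mulr_ge0 ?invr_ge0 ?vnorm_ge0// ltW.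
have t1 : t <= 1 by rewrite ge_min lexx.
have := vdot_clip_shift_ge v z c0 t1; rewrite vscale1; apply: le_trans.
rewrite vdot_clip_small//.
  by rewrite !vdotE -vnorm_sqr -tv; lra.
apply: le_trans (vnorm_add _ _) _; rewrite vnorm_scale ger0_norm// tv.
have : Num.min (vnorm v) (3 / 4 * c) <= 3 / 4 * c by rewrite ge_min lexx orbT.
lra.
Qed.

Local Open Scope ereal_scope.
Notation G := (@gauss R d).

Lemma measurable_small_noise c k :
  measurable [set z : d.-tuple R | (vnorm (vscale k z) < c / 4)%R].
Proof.
rewrite -[X in measurable X]setTI.
have mk : measurable_fun setT (fun z : d.-tuple R => vnorm (vscale k z) < c / 4)%R.
  apply: measurable_fun_ltr; last exact: measurable_cst.
  apply: measurable_vnorm; apply: measurable_vscale; first exact: measurable_cst.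
  exact: measurable_id.
exact: (mk measurableT [set true]).
Qed.

Lemma measurable_shifted_clip c k v :
  measurable_fun setT (fun z => vdot v (clip (vadd v (vscale k z)) c)).
Proof.
apply: measurable_vdot; first exact: measurable_cst.
apply: measurable_clip; apply: measurable_vadd; first exact: measurable_cst.
by apply: measurable_vscale; [exact: measurable_cst|exact: measurable_id].
Qed.

(** By symmetry of the Gaussian, twice the integral is that of [H z + H (- z)], which is at least
    [2 M] everywhere and [2 M + 2 m] on [S]. The shift by [M] keeps every integrand nonnegative. *)
Lemma gauss_clip_ge c k v : (0 < c)%R ->
  (vnorm v * c)%:E + (vnorm v * Num.min (vnorm v) (3 / 4 * c))%:E
      * G [set z | (vnorm (vscale k z) < c / 4)%R]
    <= \int[G]_z (vdot v (clip (vadd v (vscale k z)) c) + vnorm v * c)%:E.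
Proof.
move=> c0; set M := (vnorm v * c)%R; set m := (_ * Num.min _ _)%R; set S := [set z | _].
pose H z := (vdot v (clip (vadd v (vscale k z)) c) + M)%R.
have H0 z : (0 <= H z)%R.
  have := vdot_clip_le (vadd v (vscale k z)) v c0.
  by rewrite ler_norml => /andP[+ _]; rewrite /H -/M; lra.
have M0 : (0 <= M)%R by rewrite mulr_ge0 ?vnorm_ge0// ltW.
have m0 : (0 <= m)%R.
  by rewrite mulr_ge0 ?vnorm_ge0// le_min vnorm_ge0 mulr_ge0// ltW.
have mS : measurable S by exact: measurable_small_noise.
have mH : measurable_fun setT (fun z => (H z)%:E).
  apply/measurable_EFinP; apply: measurable_funD; last exact: measurable_cst.
  exact: measurable_shifted_clip.
have mHN : measurable_fun setT (fun z : d.-tuple R => (H (vscale (-1) z))%:E).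
  apply: (measurableT_comp mH); apply: measurable_vscale; first exact: measurable_cst.
  exact: measurable_id.
have HE0 z : 0 <= (H z)%:E by rewrite lee_fin.
have HN : \int[G]_z (H (vscale (-1) z))%:E = \int[G]_z (H z)%:E.
  exact: (integral_gauss_opp mH).
have lb : \int[G]_z ((2 * M)%:E + (2 * m)%:E * (\1_S z)%:E) <=
    \int[G]_z ((H z)%:E + (H (vscale (-1) z))%:E).
  apply: ge0_le_integral.
  - exact: measurableT.
  - move=> z _; rewrite -EFinM -EFinD lee_fin.
    by rewrite indicE; apply: addr_ge0; [lra|apply: mulr_ge0; [lra|exact: ler0n]].
  - apply: emeasurable_funD; first exact: measurable_cst.
    apply: emeasurable_funM; first exact: measurable_cst.
    by apply/measurable_EFinP; exact: measurable_indic.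
  - exact: emeasurable_funD.
  - move=> z _; rewrite -EFinM -!EFinD lee_fin indicE.
    have vkN : vscale k (vscale (-1) z) = vscale (-1) (vscale k z).
      by rewrite !vscaleA mulrC.
    (* On [S] the linear terms [<v, k z>] and [<v, - k z>] of the two bounds cancel; off [S] the
       antipodal inequality suffices. *)
    rewrite /H vkN; case: (boolP (z \in S)) => [|_].
      rewrite inE /S/= => zS.
      have zSN : (vnorm (vscale (-1) (vscale k z)) < c / 4)%R.
        by rewrite vnorm_scale normrN1 mul1r.
      have := vdot_clip_small_noise v c0 zS.
      have := vdot_clip_small_noise v c0 zSN.
      rewrite vdotE -/m; lra.
    have := vdot_clip_antipodal_ge0 v (vscale k z) c0.
    by rewrite mulr0; lra.
have GS : G S = (fine (G S))%:E by rewrite fineK//; exact: fin_num_measure.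
have m1S : measurable_fun setT (fun z => (\1_S z : R)%:E).
  by apply/measurable_EFinP; exact: measurable_indic.
have iS : \int[G]_z ((2 * m)%:E * (\1_S z)%:E) = (2 * m)%:E * (fine (G S))%:E.
  rewrite (ge0_integralZl G measurableT m1S); first last.
  - by rewrite lee_fin; lra.
  - by move=> z _; rewrite lee_fin indicE ler0n.
  by rewrite (integral_indic G measurableT mS) setIT -GS.
have i2M : \int[G]_z (2 * M)%:E = (2 * M)%:E.
  rewrite (integral_cst G measurableT (2 * M)%:E) -[RHS]mule1; congr (_ * _).
  exact: probability_setT.
rewrite GS; move: lb.
rewrite (ge0_integralD G measurableT (fun z _ => HE0 z) mH (fun z _ => HE0 _) mHN) HN.
rewrite (ge0_integralD G measurableT); first last.
- by apply: emeasurable_funM; first exact: measurable_cst.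
- by move=> z _; rewrite -EFinM lee_fin indicE; apply: mulr_ge0; [lra|exact: ler0n].
- exact: measurable_cst.
- by move=> z _; rewrite lee_fin; lra.
rewrite i2M iS.
have : 0 <= \int[G]_z (H z)%:E by exact: (integral_ge0 G (fun z _ => HE0 z)).
rewrite -[X in _ -> _ -> _ <= X]/(\int[G]_z (H z)%:E).
(* An infinite integral makes the bound trivial, and minus infinity is excluded by nonnegativity. *)
case: (\int[G]_z (H z)%:E) => [r _|_ _|//]; last exact: leey.
by rewrite -!EFinM -!EFinD !lee_fin; lra.
Qed.

End clip_gauss.

(** * Integration over independent vectors *)

Section independence.
Local Open Scope ereal_scope.

(** Independence makes the joint law agree with the product of the marginals on rectangles, hence
    everywhere; Tonelli then integrates the second variable first. *)
Lemma integral_indep {R : realType} {dT} {T : measurableType dT}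
  (P : probability T R) (n m : nat) (X : T -> n.-tuple R) (Y : T -> m.-tuple R)
  (nu : probability (m.-tuple R) R) (F : n.-tuple R * m.-tuple R -> \bar R) :
  measurable_fun setT X -> measurable_fun setT Y -> indep_vec P X Y ->
  (forall B, measurable B -> P (Y @^-1` B) = nu B) ->
  measurable_fun setT F -> (forall z, 0 <= F z) ->
  \int[P]_w F (X w, Y w) = \int[P]_w \int[nu]_y F (X w, y).
Proof.
move=> mX mY indep lawY mF F0.
have mXY : measurable_fun setT (fun w => (X w, Y w)) by exact: measurable_fun_pair.
pose X' : {mfun T >-> n.-tuple R} := HB.pack X (isMeasurableFun.Build _ _ _ _ _ mX).
pose Z' : {mfun T >-> (n.-tuple R * m.-tuple R)%type} :=
  HB.pack (fun w => (X w, Y w)) (isMeasurableFun.Build _ _ _ _ _ mXY).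
transitivity (\int[distribution P Z']_z F z).
  by rewrite (ge0_integral_distribution Z' mF F0).
transitivity (\int[distribution P X' \x nu]_z F z).
  apply: eq_measure_integral => A mA _; apply/esym.
  apply: product_measure_unique => // B C mB mC.
  by transitivity (P (X @^-1` B) * P (Y @^-1` C)); [exact: indep|rewrite lawY].
rewrite (fubini_tonelli1 F mF F0).
rewrite (ge0_integral_distribution X' (measurable_fun_fubini_tonelli_F F mF F0))//.
by move=> x; exact: (integral_ge0 nu (fun y _ => F0 (x, y))).
Qed.

End independence.

(** * Averaging the smoothing bound over [xi] *)

Theorem theorem6 (R : realType) (d : nat) (c : R) (v : d.-tuple R) :
  0 < c ->
  exists C : R,
  forall (dT : measure_display) (T : measurableType dT) (P : probability T R)
    (xi zeta : T -> d.-tuple R) (p : d.-tuple R -> R) (k : R),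
    0 < k ->
    measurable_fun [set: T] xi -> measurable_fun [set: T] zeta ->
    (* xi has density p *)
    has_density P xi p ->
    (* xi has zero mean *)
    (forall i : 'I_d, P.-integrable [set: T] (fun w => (tnth (xi w) i)%:E) /\
                      ('E_P[fun w => tnth (xi w) i] = 0)%E) ->
    (* finite second moment sigma_xi^2 = E ||xi||^2 *)
    ('E_P[fun w => (vnorm (xi w) ^+ 2)%R] < +oo)%E ->
    (* zeta ~ N(0, I) *)
    has_density P zeta (@std_gauss_pdf R d) ->
    (* zeta independent of xi *)
    indep_vec P xi zeta ->
    let sigma2 := fine ('E_P[fun w => (vnorm (xi w) ^+ 2)%R])%E in
    let g := fun w => clip (vadd (vadd v (xi w)) (vscale k (zeta w))) c in
    ('E_P[fun w => vdot v (g w)] >=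
       (vnorm v * Num.min (vnorm v) (3 / 4 * c))%R%:E
         * P [set w | (vnorm (vscale k (zeta w)) < c / 4)%R]
       - (C * (sigma2 / k ^+ 2))%R%:E)%E.

Proof.
(* The constant is half of the upper bound [2 M] of [f], namely [M = |v| c], which involves only [v]
   and [c]. *)
move=> c0; exists (vnorm v * c) => dT T P xi zeta p k k0 mxi mzeta _ xi_mean xi_var.
move=> zeta_gauss indep; cbv zeta.
pose sigma2 := fine ('E_P[fun w => (vnorm (xi w) ^+ 2)%R])%E.
pose g w := clip (vadd (vadd v (xi w)) (vscale k (zeta w))) c.
rewrite -/sigma2 -[fun w => vdot v _]/(fun w => vdot v (g w)).
have lawz := has_density_std_gauss zeta_gauss.
set M := vnorm v * c.
pose f (z : d.-tuple R) : R := vdot v (clip (vadd v (vscale k z)) c) + M.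
have f0K z : 0 <= f z <= M + M.
  have := vdot_clip_le (vadd v (vscale k z)) v c0.
  by rewrite -/M ler_norml /f => /andP[]; lra.
have mf : measurable_fun setT f.
  by apply: measurable_funD; [exact: measurable_shifted_clip|exact: measurable_cst].
have [b fb] := gauss_smoothing_ge mf f0K.
pose u w := vscale k^-1 (xi w).
have mu : measurable_fun setT u by apply: measurable_vscale; first exact: measurable_cst.
pose F (z : d.-tuple R * d.-tuple R) : \bar R := (f (vadd z.2 (vscale k^-1 z.1)))%:E.
have mF : measurable_fun setT F.
  apply/measurable_EFinP; apply: (measurableT_comp mf).
  apply: measurable_vadd; first exact: measurable_snd.
  by apply: measurable_vscale; [exact: measurable_cst|exact: measurable_fst].
have F0 z : (0 <= F z)%E by rewrite lee_fin; case/andP: (f0K (vadd z.2 (vscale k^-1 z.1))).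
have mxz : measurable_fun setT (fun w => (xi w, zeta w)) by exact: measurable_fun_pair.
have iF : P.-integrable setT (fun w => F (xi w, zeta w)).
  apply: (le_integrable measurableT _ _
    (finite_measure_integrable_cst P (M + M) measurableT)).
    exact: (measurableT_comp mF mxz).
  move=> w _ /=; rewrite lee_fin; case/andP: (f0K (vadd (zeta w) (vscale k^-1 (xi w)))).
  by move=> h0 hM; rewrite ger0_norm// (le_trans hM)// ler_norm.
(* Here [v + k (zeta + xi / k) = v + xi + k zeta], and the shift by [M] integrates to [M] under a
   probability. *)
have Eg : ('E_P[fun w => vdot v (g w)] = \int[P]_w F (xi w, zeta w) - M%:E)%E.
  have -> : M%:E = (\int[P]_w (cst M w)%:E)%E.
    rewrite (integral_cst P measurableT M%:E) -[LHS]mule1; congr (_ * _)%E.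
    exact/esym/probability_setT.
  rewrite -(integralB measurableT iF (finite_measure_integrable_cst P M measurableT)).
  rewrite unlock; apply: eq_integral => w _; rewrite -EFinN -EFinD addrK.
  congr (vdot v (clip _ c))%:E; apply: eq_from_tnth => i; rewrite !tnth_mktuple.
  by field; rewrite gt_eqF.
pose W w := (\int[gauss d]_y F (xi w, y))%E.
have EW : (\int[P]_w F (xi w, zeta w) = \int[P]_w W w)%E.
  exact: integral_indep.
have W0 w : (0 <= W w)%E by exact: (integral_ge0 (gauss d) (fun y _ => F0 (xi w, y))).
have mW : measurable_fun setT W.
  exact: (measurableT_comp (measurable_fun_fubini_tonelli_F F mF F0) mxi).
have iW : P.-integrable setT W.
  apply/integrableP; split => //.
  under eq_integral do rewrite gee0_abs//.
  by rewrite -EW ltey_eq (integrable_fin_num measurableT iF).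
pose Q w := vnorm (xi w) ^+ 2.
have EQ : ('E_P[Q] = \int[P]_w (Q w)%:E)%E by rewrite unlock.
have mQ : measurable_fun setT Q by apply: measurable_funX; exact: measurable_vnorm.
have iQ : P.-integrable setT (EFin \o Q).
  apply/integrableP; split; first exact/measurable_EFinP.
  under eq_integral do rewrite /= ger0_norm ?exprn_ge0 ?vnorm_ge0//.
  by rewrite -EQ.
have sigma2E : (\int[P]_w (Q w)%:E = sigma2%:E)%E.
  by rewrite /sigma2 EQ fineK//; exact: (integrable_fin_num measurableT iQ).
pose bxi w := (\sum_(i < d) (tnth b i / k)%:E * (tnth (xi w) i)%:E)%E.
have ibi i : P.-integrable setT (fun w => (tnth b i / k)%:E * (tnth (xi w) i)%:E)%E.
  by apply: integrableZl => //; case: (xi_mean i).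
have ib : P.-integrable setT bxi.
  by apply: integrable_sum => // i _; exact: ibi.
(* The linear correction [<b, xi / k>] vanishes on average because [b] is deterministic and [xi] is
   centred. *)
have b0 : (\int[P]_w bxi w = 0)%E.
  rewrite /bxi integral_sum// big1// => i _.
  have [ixi mean0] := xi_mean i.
  rewrite (integralZl measurableT ixi).
  by move: mean0; rewrite unlock => ->; rewrite mule0.
have bu w : (vdot b (u w))%:E = bxi w.
  rewrite /bxi /vdot -sumEFin; apply: eq_bigr => i _; rewrite tnth_mktuple -EFinM.
  by congr EFin; ring.
have uu w : vdot (u w) (u w) = Q w / k ^+ 2.
  by rewrite /u /Q !vdotE vnorm_sqr; field; rewrite gt_eqF.
have if1 : (gauss d).-integrable setT (EFin \o f).
  apply: (le_integrable measurableT _ _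
    (finite_measure_integrable_cst (gauss d) (M + M) measurableT)).
    exact/measurable_EFinP.
  move=> z _ /=; rewrite lee_fin; case/andP: (f0K z).
  by move=> h0 hM; rewrite ger0_norm// (le_trans hM)// ler_norm.
have [A AE] : exists A : R, (\int[gauss d]_z (f z)%:E = A%:E)%E.
  exists (fine (\int[gauss d]_z (f z)%:E)).
  by rewrite fineK//; exact: (integrable_fin_num measurableT if1).
have iQk : P.-integrable setT (fun w => (M / k ^+ 2)%:E * (Q w)%:E)%E.
  exact: integrableZl.
have iA : P.-integrable setT (fun w => A%:E + bxi w)%E.
  apply: integrableD => //; exact: (finite_measure_integrable_cst P A measurableT).
(* Integrates over [xi] the smoothing bound at the shift [xi / k]; with [K = 2 M] the quadratic loss
   is [M |xi|^2 / k^2]. *)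
have lbW : (A%:E - (M * (sigma2 / k ^+ 2))%:E <= \int[P]_w W w)%E.
  have <- : (\int[P]_w ((A%:E + bxi w) - (M / k ^+ 2)%:E * (Q w)%:E) =
      A%:E - (M * (sigma2 / k ^+ 2))%:E)%E.
    rewrite (integralB measurableT iA iQk).
    rewrite (integralD measurableT (finite_measure_integrable_cst P A measurableT) ib).
    rewrite b0 adde0 (integralZl measurableT iQ) sigma2E -EFinM.
    congr (_ - _%:E)%E; last by ring.
    rewrite (integral_cst P measurableT A%:E) -[RHS]mule1; congr (_ * _)%E.
    exact: probability_setT.
  apply: (le_integral measurableT _ iW); first exact: integrableB.
  move=> w _; apply: le_trans (fb (u w)); rewrite AE -bu uu -!EFinM -EFinN -!EFinD lee_fin.
  by lra.
(* [A] is the mean for Gaussian noise alone, still shifted by [M]; this [M] cancels the one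
   subtracted in [Eg]. *)
have := gauss_clip_ge k v c0; rewrite AE -/M => hA.
have lawS : P [set w | vnorm (vscale k (zeta w)) < c / 4] =
    gauss d [set z | vnorm (vscale k z) < c / 4].
  exact: (lawz _ (measurable_small_noise c k)).
rewrite Eg EW lawS.
have GS : gauss d [set z | vnorm (vscale k z) < c / 4] \is a fin_num.
  by apply: fin_num_measure; exact: measurable_small_noise.
move: hA lbW; rewrite -(fineK GS).
rewrite -(fineK (integrable_fin_num measurableT iW)).
by rewrite -!EFinM -!EFinN -!EFinD !lee_fin; lra.
Qed.
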